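(* Let $\mathcal{M}$ be a finite set of agents with the dynamics, constraints, neighbor sets $\mathcal{N}_i(t)$, cells, safety envelopes, local problems $\mathrm{FHOCP}_i(t)$ and closed loop described in the context. Assume that the problem $\mathrm{FHOCP}_i(t)$ is feasible at time $t=0$ (for every $i\in\mathcal{M}$), that at each time $t$ the cells $\mathcal{P}^{N+1}_{i,t}$, $i\in\mathcal{M}$, used in the problems are cells in the sense of the context and form an admissible family, and that for each $i\in\mathcal{M}$ the sets $\mathcal{E}_i^N$ form a safety envelope. Then the problem $\mathrm{FHOCP}_i(t)$ is recursively feasible. Moreover, the resulting closed-loop system satisfies the local state and input constraints, $x_i(t)\in\mathcal{X}_i$ and $u_i(t)\in\mathcal{U}_i$ for all $i\in\mathcal{M}$, and the collision-avoidance constraint $\|p_i(t)-p_j(t)\|-\epsilon\ge 0$ for all $i,j\in\mathcal{M}$ with $i\ne j$, for all $t\ge 0$, even under anytime plug-and-play changes of the network topology.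
   Context: **Agents.** $\mathcal{M}$ is a finite set of agents. Agent $i\in\mathcal{M}$ has dynamics $x_i(t+1)=f_i(x_i(t),u_i(t))$, $t\in\mathbb{N}=\{0,1,2,\dots\}$, with $f_i:\mathbb{R}^{n_i}\times\mathbb{R}^{m_i}\to\mathbb{R}^{n_i}$, and position $p_i(t)=C_ix_i(t)\in\mathbb{R}^3$, where $C_i\in\mathbb{R}^{3\times n_i}$ selects the first three entries of the state. Local constraint sets are $\mathcal{X}_i\subseteq\mathbb{R}^{n_i}$ and $\mathcal{U}_i\subseteq\mathbb{R}^{m_i}$. The dynamics are position invariant: with $\phi(p)=[p^\top,0,\dots,0]^\top\in\mathbb{R}^{n_i}$, one has $f_i(x+\phi(p),u)=f_i(x,u)+\phi(p)$ for all $p\in\mathbb{R}^3$, $x$, $u$. A constant $\epsilon>0$ is fixed. **Set notation.** $\mathcal{B}_{\epsilon/2}$ is the open Euclidean ball of radius $\epsilon/2$ in $\mathbb{R}^3$ centered at the origin (it represents the physical size of an agent). For sets, $\mathcal{S}\oplus\mathcal{T}=\{s+\tau: s\in\mathcal{S},\tau\in\mathcal{T}\}$ and $\mathcal{S}\ominus\mathcal{T}=\{x: x+\tau\in\mathcal{S}\ \forall \tau\in\mathcal{T}\}$. $\mathbb{N}_a^b=\{n\in\mathbb{N}: a\le n\le b\}$. $N\ge 1$ is the horizon length. The subscript $k|t$ denotes a quantity at time $t+k$ predicted at time $t$. **Communication, neighbors and awareness sets.** For given $A\in\mathbb{R}^{n_c\times 3}$ and $b\in\mathbb{R}^{n_c}$,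 let $\bar{\mathcal{R}}(p)=\{\xi\in\mathbb{R}^3: A(\xi-p)\le b/2\}$ (componentwise inequality). The polytope $\{\xi: A\xi\le b\}$ is centrally symmetric about the origin and $\mathcal{B}_{\epsilon/2}\subseteq\bar{\mathcal{R}}(\mathbf{0})$. The neighbor set of agent $i$ at time $t$ is $\mathcal{N}_i(t)=\{j\in\mathcal{M}\setminus\{i\}: \bar{\mathcal{R}}(p_i(t))\cap\bar{\mathcal{R}}(p_j(t))\neq\emptyset\}$. The neighbor sets induce a time-varying undirected communication graph; anytime plug-and-play means that this graph may change arbitrarily over time as agents move, enter, or leave the communication range, without approval of other agents. The awareness set is $\mathcal{A}(p)=\bar{\mathcal{R}}(p)\ominus\mathcal{B}_{\epsilon/2}$. **Cells.** A cell $\mathcal{P}_{i,k|t}$ for agent $i$ at prediction step $k$ and time $t$ is a convex subset of $\{C_ix: x\in\mathcal{X}_i\}$, and $\mathcal{P}^{N+1}_{i,t}=\{\mathcal{P}_{i,0|t},\dots,\mathcal{P}_{i,N|t}\}$. A family $\{\mathcal{P}^{N+1}_{i,t}\}_{i\in\mathcal{M}}$ is admissible at time $t$ if for all $i\in\mathcal{M}$, $j\in\mathcal{N}_i(t)$ and $k\in\mathbb{N}_0^N$: $(\mathcal{P}_{i,k|t}\oplus\mathcal{B}_{\epsilon/2})\cap(\mathcal{P}_{j,k|t}\oplus\mathcal{B}_{\epsilon/2})=\emptyset$. **Safety envelopes.** A safety envelope for agent $i$ is a sequence (fixed over time) $\mathcal{E}_i^N=\{\mathcal{E}_{i,0},\dots,\mathcal{E}_{i,N-1}\}$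 of convex sets with $\mathcal{E}_{i,k}=\alpha_{i,k}\mathcal{A}(\mathbf{0})$, where $\alpha_{i,k}\ge 0$, $\alpha_{i,k}\ge\alpha_{i,k+1}$ and $\sum_{k=0}^{N-1}\alpha_{i,k}\le 1$; consequently $\bigoplus_{k=0}^{N-1}\mathcal{E}_{i,k}\subseteq\mathcal{A}(\mathbf{0})$. **Local problem $\mathrm{FHOCP}_i(t)$.** Given $x_i(t)$, the cells $\mathcal{P}^{N+1}_{i,t}$ and the safety envelope $\mathcal{E}_i^N$, minimize $\sum_{k=0}^{N-1}J_i(x_{i,k|t},u_{i,k|t})$, with $J_i$ a given stage cost, over $x_{i,0|t},\dots,x_{i,N|t}$, $u_{i,0|t},\dots,u_{i,N-1|t}$, $\bar x_{i|t}$, $\bar u_{i|t}$, subject to - $x_{i,0|t}=x_i(t)$; - $x_{i,k+1|t}=f_i(x_{i,k|t},u_{i,k|t})$ and $(x_{i,k|t},u_{i,k|t})\in\mathcal{X}_i\times\mathcal{U}_i$ for $k\in\mathbb{N}_0^{N-1}$; - $p_{i,k|t}=C_ix_{i,k|t}$ and $p_{i,k|t}\in\mathcal{P}_{i,k|t}$ for $k\in\mathbb{N}_0^N$; - $p_{i,k+1|t}-p_{i,k|t}\in\mathcal{E}_{i,k}$ for $k\in\mathbb{N}_0^{N-1}$; - $x_{i,N|t}=\bar x_{i|t}$, $\bar x_{i|t}=f_i(\bar x_{i|t},\bar u_{i|t})$, $(\bar x_{i|t},\bar u_{i|t})\in\mathcal{X}_i\times\mathcal{U}_i$. The problem is feasible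 if some choice of variables satisfies all constraints. **Closed loop.** At each time $t$ the neighbor sets $\mathcal{N}_i(t)$ are computed from the current positions and kept fixed while the problems at time $t$ are solved; the cells $\mathcal{P}^{N+1}_{i,t}$ are computed, using the position trajectories planned at the previous time step and exchanged with the current neighbors; every agent computes an optimal solution of $\mathrm{FHOCP}_i(t)$ and applies its first input $u_i(t)=u^*_{i,0|t}$, and the state evolves by $x_i(t+1)=f_i(x_i(t),u_i(t))$. **Recursive feasibility.** The problem is recursively feasible if, whenever $\mathrm{FHOCP}_i(t)$ is feasible for every $i\in\mathcal{M}$ at time $t$ and the agents apply the first inputs of their optimal solutions, $\mathrm{FHOCP}_i(t+1)$ is feasible for every $i\in\mathcal{M}$; hence, from feasibility at $t=0$, it is feasible for all $t\ge 0$.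
   Formalization: It is additionally assumed that the cells at time t+1 contain the positions planned at time t (shifted, terminal steady state held) whenever some admissible family of cells contains them; otherwise empty cells, convex and admissible, would make the problem infeasible at time t+1. *)

(* Defs.v *)
From mathcomp Require Import all_boot all_order all_algebra.
From mathcomp Require Import classical_sets reals topology normedtype convex.

Set Implicit Arguments.
Unset Strict Implicit.
Unset Printing Implicit Defensive.

Import Order.TTheory GRing.Theory Num.Theory.
Import numFieldNormedType.Exports.

Local Open Scope classical_set_scope.
Local Open Scope ring_scope.

(* The library norm on 'cV[R]_n is the sup norm, hence [enorm]. *)
Section Geometry.
Context {R : realType}.

Definition enorm n (v : 'cV[R]_n) : R := Num.sqrt (\sum_i v i 0 ^+ 2).

Definition eball n (r : R) : set 'cV[R]_n := [set v | enorm v < r].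

Definition mink_add n (S T : set 'cV[R]_n) : set 'cV[R]_n :=
  [set s + t | s in S & t in T].

Definition mink_sub n (S T : set 'cV[R]_n) : set 'cV[R]_n :=
  [set x | forall t, T t -> S (x + t)].

Definition polyhedron m n (A : 'M[R]_(m, n)) (b : 'cV[R]_m) : set 'cV[R]_n :=
  [set xi | forall r, (A *m xi) r 0 <= b r 0].

Definition is_polytope m (A : 'M[R]_(m, 3)) (b : 'cV[R]_m) : Prop :=
  bounded_set (polyhedron A b).

Definition centrally_symmetric n (S : set 'cV[R]_n) : Prop :=
  forall xi, S xi -> S (- xi).

End Geometry.

Record network (R : realType) (M : finType) := Network {
  sdim : M -> nat;
  idim : M -> nat;
  dyn : forall i, 'cV[R]_(sdim i) -> 'cV[R]_(idim i) -> 'cV[R]_(sdim i);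
  stateset : forall i, set 'cV[R]_(sdim i);
  inputset : forall i, set 'cV[R]_(idim i);
  stage_cost : forall i, 'cV[R]_(sdim i) -> 'cV[R]_(idim i) -> R;
  eps : R;
  horizon : nat;
  ncomm : nat;
  comm_A : 'M[R]_(ncomm, 3);
  comm_b : 'cV[R]_ncomm }.

(* The decision variables.  Only the entries x_k with k <= N and u_k with k < N
   enter the problem; the further entries of the sequences are irrelevant. *)
Record plan (R : realType) (n m : nat) := Plan {
  plan_x : nat -> 'cV[R]_n;
  plan_u : nat -> 'cV[R]_m;
  plan_xbar : 'cV[R]_n;
  plan_ubar : 'cV[R]_m }.

Section Network.
Context {R : realType} {M : finType}.
Variable S : network R M.

Local Notation N := (horizon S).
Local Notation ball := (@eball R 3 (eps S / 2)).
Local Notation X i := (@stateset R M S i).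
Local Notation U i := (@inputset R M S i).
Local Notation f i := (@dyn R M S i).
Local Notation plan i := (plan R (sdim S i) (idim S i)).

(* [pid_mx 3 : 'M_(3, n)] is the C_i selecting the first three entries, and
   [pid_mx 3 : 'M_(n, 3)] is p |-> (p, 0, ..., 0); both readings need
   3 <= sdim S i. *)
Definition pos i (x : 'cV[R]_(sdim S i)) : 'cV[R]_3 := pid_mx 3 *m x.

Definition phi i (p : 'cV[R]_3) : 'cV[R]_(sdim S i) := pid_mx 3 *m p.

Definition position_invariant : Prop :=
  forall i p x u, f i (x + phi i p) u = f i x u + phi i p.

Definition commset (p : 'cV[R]_3) : set 'cV[R]_3 :=
  [set xi | forall r, (comm_A S *m (xi - p)) r 0 <= comm_b S r 0 / 2].

Definition neighbors (x : forall i, 'cV[R]_(sdim S i)) (i : M) : set M :=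
  [set j | j != i /\ commset (pos (x i)) `&` commset (pos (x j)) !=set0].

Definition awareness (p : 'cV[R]_3) : set 'cV[R]_3 :=
  mink_sub (commset p) ball.

Definition is_cell i (P : set 'cV[R]_3) : Prop :=
  convex_set P /\ P `<=` [set pos x | x in X i].

(* A cell family is indexed by the agent and the prediction step 0 <= k <= N. *)
Definition are_cells (P : M -> nat -> set 'cV[R]_3) : Prop :=
  forall i k, (k <= N)%N -> is_cell i (P i k).

Definition admissible (x : forall i, 'cV[R]_(sdim S i))
    (P : M -> nat -> set 'cV[R]_3) : Prop :=
  forall i j k, neighbors x i j -> (k <= N)%N ->
    mink_add (P i k) ball `&` mink_add (P j k) ball = set0.

Definition safety_envelope (E : nat -> set 'cV[R]_3) : Prop :=
  (forall k, (k < N)%N -> convex_set (E k)) /\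
  exists alpha : nat -> R,
    [/\ forall k, (k < N)%N -> E k = [set alpha k *: v | v in awareness 0],
        forall k, (k < N)%N -> 0 <= alpha k,
        forall k, (k.+1 < N)%N -> alpha k.+1 <= alpha k
      & \sum_(k < N) alpha k <= 1].

Section Problem.
Variables (i : M) (x : 'cV[R]_(sdim S i)) (P E : nat -> set 'cV[R]_3).

Definition fhocp_constraints (z : plan i) : Prop :=
  plan_x z 0 = x /\
  (forall k, (k < N)%N ->
    [/\ plan_x z k.+1 = f i (plan_x z k) (plan_u z k),
        X i (plan_x z k) & U i (plan_u z k)]) /\
  (forall k, (k <= N)%N -> P k (pos (plan_x z k))) /\
  (forall k, (k < N)%N -> E k (pos (plan_x z k.+1) - pos (plan_x z k))) /\
  [/\ plan_x z N = plan_xbar z,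
      plan_xbar z = f i (plan_xbar z) (plan_ubar z),
      X i (plan_xbar z) & U i (plan_ubar z)].

Definition fhocp_cost (z : plan i) : R :=
  \sum_(k < N) @stage_cost R M S i (plan_x z k) (plan_u z k).

Definition fhocp_feasible : Prop := exists z, fhocp_constraints z.

Definition fhocp_optimal (z : plan i) : Prop :=
  fhocp_constraints z /\
  forall z', fhocp_constraints z' -> fhocp_cost z <= fhocp_cost z'.

End Problem.

Variable E : M -> nat -> set 'cV[R]_3.

Record run := Run {
  state : nat -> forall i, 'cV[R]_(sdim S i);
  input : nat -> forall i, 'cV[R]_(idim S i);
  cells : nat -> M -> nat -> set 'cV[R]_3;
  sol : nat -> forall i, plan i }.

Variable r : run.

Definition feasible_at (t : nat) (i : M) : Prop :=
  fhocp_feasible (state r t i) (cells r t i) (E i).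

Definition applies_optimal (t : nat) (i : M) : Prop :=
  fhocp_optimal (state r t i) (cells r t i) (E i) (sol r t i) /\
  input r t i = plan_u (sol r t i) 0.

(* The position that the plan computed at time t assigns to time t + 1 + k.
   For k = N this lies one step beyond the end of the plan, where the terminal
   steady state is held. *)
Definition planned_pos (t : nat) (i : M) (k : nat) : 'cV[R]_3 :=
  pos (plan_x (sol r t i) (minn k.+1 N)).

Definition follows_plan (t : nat) (P : M -> nat -> set 'cV[R]_3) : Prop :=
  forall i k, (k <= N)%N -> P i k (planned_pos t i k).

(* The third clause is what it means to compute the cells of time t + 1 from
   the plans of time t: the cells are built around the planned positions
   whenever these can be enclosed in an admissible family of cells, with respect
   to the neighbors at time t + 1.  That they can be enclosed is not assumed,
   and without this clause the cells of time t + 1 could all be empty.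
   No clause restricts how the neighbor sets vary with time. *)
Definition closed_loop : Prop :=
  [/\ forall t i, state r t.+1 i = f i (state r t i) (input r t i),
      forall t i, feasible_at t i -> applies_optimal t i
    & forall t, (forall i, feasible_at t i) ->
        (exists Q, [/\ are_cells Q, admissible (state r t.+1) Q
                     & follows_plan t Q]) ->
        follows_plan t (cells r t.+1)].

Definition recursively_feasible : Prop :=
  forall t, (forall i, feasible_at t i) -> (forall i, applies_optimal t i) ->
    forall i, feasible_at t.+1 i.

End Network.

(* Main.v *)
Require Import Defs.
From mathcomp Require Import all_boot all_order all_algebra.
From mathcomp Require Import classical_sets reals topology normedtype convex.
From mathcomp Require Import boolp lra.

Import Order.TTheory GRing.Theory Num.Theory.
Import numFieldNormedType.Exports.

Local Open Scope classical_set_scope.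
Local Open Scope ring_scope.

(** Every ball of radius eps/2 that the argument has to keep apart from another
    one is centered at a planned position.  Two mechanisms separate the plans
    computed at a common time t.

    Agents that are neighbors at time t are separated by their cells.  Agents
    that are not neighbors have disjoint communication sets, and the envelope
    constraint keeps their plans, with the ball around each position, inside
    them: the displacement from the current position is a sum of terms alpha_k v_k with v_k in the awareness
    set of the origin and sum alpha_k <= 1, hence lies in that set by convexity
    ([plan_in_awareness]).  Together, any two distinct agents have disjoint balls
    at every step of the plans of time t, whatever the graph
    ([planned_balls_disjoint]).  This is why arbitrary changes of the neighbor
    sets between t and t + 1 are harmless.

    At step 0 this is collision avoidance at time t: if two centers were closer
    than eps, their midpoint would lie in both balls.  At the later steps it
    says that the singletons of the planned positions form an admissible family
    of cells for time t + 1 with respect to any neighbors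
    ([plans_enclosable]).  The cells actually used at time t + 1 must then
    contain the planned positions, so the old plan, shifted by one step and
    extended by its terminal steady state, satisfies the new cell constraints.
    It satisfies the envelope constraints because the envelope sets are
    decreasing and contain the origin ([shifted_plan_feasible]). *)

(** * Euclidean balls *)

Lemma enormZ (R : realType) n (a : R) (v : 'cV[R]_n) :
  enorm (a *: v) = `|a| * enorm v.
Proof.
rewrite /enorm.
under eq_bigr => i _ do rewrite mxE exprMn.
by rewrite -mulr_sumr sqrtrM ?sqr_ge0// sqrtr_sqr.
Qed.

Lemma enorm_ge_of_disjoint_balls (R : realType) n (e : R) (a b : 'cV[R]_n) :
  mink_add [set a] (eball (e / 2)) `&` mink_add [set b] (eball (e / 2)) = set0 ->
  e <= enorm (a - b).
Proof.
move=> disj; rewrite leNgt; apply/negP => lt_e.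
suff : set0 (2^-1 *: (a + b)) by [].
rewrite -disj; split.
- exists a => //; exists ((- 2^-1) *: (a - b)).
    by rewrite /eball /= enormZ normrN ger0_norm; lra.
  by apply/matrixP => i j; rewrite !mxE; lra.
- exists b => //; exists (2^-1 *: (a - b)).
    by rewrite /eball /= enormZ ger0_norm; lra.
  by apply/matrixP => i j; rewrite !mxE; lra.
Qed.

Lemma mink_add_subl (R : realType) n (A B T : set 'cV[R]_n) :
  A `<=` B -> mink_add A T `<=` mink_add B T.
Proof. by move=> AB _ [s As [t Tt <-]]; exists s; [exact: AB | exists t]. Qed.

(** * Awareness sets and safety envelopes *)

Lemma awareness_translate {R : realType} {M : finType} (S : network R M) p d :
  awareness S 0 d -> awareness S p (p + d).
Proof.
move=> Ad t Bt r; have := Ad t Bt r.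
by rewrite subr0 -(addrA p) (addrC p) addrK.
Qed.

(** For a row of the communication matrix with bound c and value l at a point
    of the ball, membership of v_k bounds the row at v_k by c - l.  The ball
    hypothesis gives l <= c, so the weight 1 - sum alpha_k left over goes to
    the origin. *)
Lemma awareness_weighted_sum {R : realType} {M : finType} (S : network R M)
    (ball_sub : eball (eps S / 2) `<=` commset S 0)
    m (alpha : nat -> R) (v : nat -> 'cV[R]_3) :
  (forall k, (k < m)%N -> 0 <= alpha k) -> \sum_(k < m) alpha k <= 1 ->
  (forall k, (k < m)%N -> awareness S 0 (v k)) ->
  awareness S 0 (\sum_(k < m) alpha k *: v k).
Proof.
move=> alpha_ge0 alpha_le1 Av t Bt r; rewrite subr0 mulmxDr mxE mulmx_sumr summxE.
set c := comm_b S r 0 / 2; set l := (comm_A S *m t) r 0.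
have lc : l <= c by have := ball_sub t Bt r; rewrite subr0.
have term_le (k : 'I_m) :
    (comm_A S *m (alpha k *: v k)) r 0 <= alpha k * (c - l).
  rewrite -scalemxAr mxE ler_wpM2l ?alpha_ge0 // lerBrDr.
  by have := Av k (ltn_ord k) t Bt r; rewrite subr0 mulmxDr mxE.
have := @ler_sum _ _ (index_enum 'I_m) xpredT _ _ (fun k _ => term_le k).
rewrite -mulr_suml; nra.
Qed.

Lemma awareness0 {R : realType} {M : finType} (S : network R M)
    (ball_sub : eball (eps S / 2) `<=` commset S 0) :
  awareness S 0 0.
Proof. by move=> t Bt; rewrite add0r; exact: ball_sub. Qed.

Lemma awareness_scale {R : realType} {M : finType} (S : network R M)
    (ball_sub : eball (eps S / 2) `<=` commset S 0) (a : R) v :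
  0 <= a <= 1 -> awareness S 0 v -> awareness S 0 (a *: v).
Proof.
move=> /andP[a0 a1] Av.
have := @awareness_weighted_sum _ _ S ball_sub 1 (fun=> a) (fun=> v).
by rewrite !big_ord1; apply.
Qed.

Lemma safety_envelope0 {R : realType} {M : finType} (S : network R M)
    (ball_sub : eball (eps S / 2) `<=` commset S 0) (E : nat -> set 'cV[R]_3) k :
  safety_envelope S E -> (k < horizon S)%N -> E k 0.
Proof.
move=> [_ [alpha [EE _ _ _]]] kN; rewrite EE //.
by exists 0; [exact: awareness0 | rewrite scaler0].
Qed.

(** With 0 in the awareness set, its dilations are nested: the point with
    coefficient alpha_(k+1) is the one with coefficient alpha_k on the vector
    scaled by the ratio of the two. *)
Lemma safety_envelope_nonincreasing {R : realType} {M : finType}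
    (S : network R M) (ball_sub : eball (eps S / 2) `<=` commset S 0)
    (E : nat -> set 'cV[R]_3) k :
  safety_envelope S E -> (k.+1 < horizon S)%N -> E k.+1 `<=` E k.
Proof.
move=> [_ [alpha [EE alpha_ge0 alpha_dec _]]] kN.
have kN' := ltnW kN; rewrite !EE // => _ [v Av <-].
have a0 := alpha_ge0 _ kN; have aS := alpha_dec _ kN.
have [ak0|ak_neq0] := eqVneq (alpha k) 0.
  exists 0; first exact: awareness0.
  by rewrite (_ : alpha k.+1 = 0) ?scaler0 ?scale0r //; lra.
have ak_gt0 : 0 < alpha k by rewrite lt_def ak_neq0 alpha_ge0.
exists ((alpha k.+1 / alpha k) *: v).
  apply: awareness_scale => //.
  by rewrite divr_ge0 ?(ltW ak_gt0) //= ler_pdivrMr // mul1r.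
by rewrite scalerA mulrC divfK.
Qed.

(** Telescoping the steps of the plan turns the displacement into a weighted
    sum with total weight at most 1. *)
Lemma plan_in_awareness {R : realType} {M : finType} {S : network R M}
    (ball_sub : eball (eps S / 2) `<=` commset S 0)
    {i : M} {x : 'cV[R]_(sdim S i)} {P E : nat -> set 'cV[R]_3}
    {z : plan R (sdim S i) (idim S i)} :
  safety_envelope S E -> fhocp_constraints x P E z ->
  forall m, (m <= horizon S)%N -> awareness S (pos x) (pos (plan_x z m)).
Proof.
move=> [_ [alpha [EE alpha_ge0 _ alpha_le1]]] [x0 [_ [_ [Ez _]]]] m mN.
pose step k := pos (plan_x z k.+1) - pos (plan_x z k).
have step_in k : (k < horizon S)%N ->
    exists2 v, awareness S 0 v & alpha k *: v = step k.
  by move=> kN; have := Ez _ kN; rewrite EE.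
have /choice[v vP] : forall k, exists v, (k < horizon S)%N ->
    awareness S 0 v /\ alpha k *: v = step k.
  move=> k; case: (ltnP k (horizon S)) => [/step_in[v Av vE]|_].
    by exists v.
  by exists 0.
have -> : pos (plan_x z m) = pos x + \sum_(k < m) alpha k *: v k.
  rewrite -x0; elim: m mN => [|m IH] mN; first by rewrite big_ord0 addr0.
  by rewrite big_ord_recr addrA -IH ?(ltnW mN) //= (vP m mN).2 /step addrC subrK.
apply/awareness_translate/awareness_weighted_sum => //.
- by move=> k km; apply: alpha_ge0; exact: leq_trans mN.
- apply: le_trans alpha_le1; rewrite (big_ord_widen _ alpha mN).
  rewrite [leRHS](bigID (fun k : 'I__ => (k < m)%N)) /= lerDl.
  by apply: sumr_ge0 => k _; exact: alpha_ge0.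
- by move=> k km; apply: (vP k _).1; exact: leq_trans mN.
Qed.

(** * Separation of the plans computed at a common time *)

(** A common point of the two balls would put it in both communication sets,
    which makes the agents neighbors; but neighbors have separated cells. *)
Lemma planned_balls_disjoint {R : realType} {M : finType} {S : network R M}
    (ball_sub : eball (eps S / 2) `<=` commset S 0)
    {x : forall i, 'cV[R]_(sdim S i)} {P E : M -> nat -> set 'cV[R]_3}
    {z : forall i, plan R (sdim S i) (idim S i)} :
  (forall i, safety_envelope S (E i)) -> admissible x P ->
  (forall i, fhocp_constraints (x i) (P i) (E i) (z i)) ->
  forall i j m, i != j -> (m <= horizon S)%N ->
  mink_add [set pos (plan_x (z i) m)] (eball (eps S / 2)) `&`
  mink_add [set pos (plan_x (z j) m)] (eball (eps S / 2)) = set0.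
Proof.
move=> envE admP zP i j m ij mN; apply/seteqP; split => // y [yi yj].
have in_cell k : [set pos (plan_x (z k) m)] `<=` P k m.
  by move=> _ ->; have [_ [_ [Pz _]]] := zP k; exact: Pz.
have in_comm k : mink_add [set pos (plan_x (z k) m)] (eball (eps S / 2)) y ->
    commset S (pos (x k)) y.
  move=> [_ -> [t Bt <-]].
  exact: (plan_in_awareness ball_sub (envE k) (zP k) _ mN _ Bt).
have Nij : neighbors x i j.
  by split; [rewrite eq_sym | exists y; split; exact: in_comm].
rewrite -(admP i j m Nij mN); split.
- exact: mink_add_subl (in_cell i) _ yi.
- exact: mink_add_subl (in_cell j) _ yj.
Qed.

(** * Persistence of feasibility *)

(** The index is capped at N because the last state of the old plan is held one
    step longer, by the steady input. *)
Definition shifted_plan {R : realType} {n m} (N : nat) (z : plan R n m) :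
    plan R n m :=
  Plan (fun k => plan_x z (minn k.+1 N))
       (fun k => if (k.+1 < N)%N then plan_u z k.+1 else plan_ubar z)
       (plan_xbar z) (plan_ubar z).

Lemma shifted_plan_feasible {R : realType} {M : finType} {S : network R M}
    (horizon_ge1 : (1 <= horizon S)%N)
    (ball_sub : eball (eps S / 2) `<=` commset S 0)
    {i : M} {x : 'cV[R]_(sdim S i)} {P P' E : nat -> set 'cV[R]_3}
    {z : plan R (sdim S i) (idim S i)} :
  safety_envelope S E -> fhocp_constraints x P E z ->
  (forall k, (k <= horizon S)%N ->
    P' k (pos (plan_x z (minn k.+1 (horizon S))))) ->
  fhocp_constraints (dyn x (plan_u z 0)) P' E (shifted_plan (horizon S) z).
Proof.
move=> envE [x0 [dz [_ [Ez [zN fbar Xbar Ubar]]]]] P'z.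
split=> /=.
  by rewrite (minn_idPl horizon_ge1); have [-> _ _] := dz 0%N horizon_ge1; rewrite x0.
split; [|split; [|split; [|split]]] => //=; last by rewrite (minn_idPr (leqnSn _)).
- move=> k kN; rewrite (minn_idPl kN); case: ifPn => [kN1|].
    by rewrite (minn_idPl kN1); exact: dz.
  rewrite -leqNgt => Nk; rewrite (minn_idPr (leqW Nk)).
  have -> : k.+1 = horizon S by apply/eqP; rewrite eqn_leq kN.
  by rewrite zN.
- move=> k kN; rewrite (minn_idPl kN); case: (ltnP k.+1 (horizon S)) => [kN1|Nk].
    rewrite (minn_idPl kN1).
    exact: (safety_envelope_nonincreasing _ ball_sub _ _ envE kN1) (Ez _ kN1).
  (* The step that holds the steady state has zero displacement. *)
  have <- : k.+1 = horizon S by apply/eqP; rewrite eqn_leq kN.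
  rewrite (minn_idPr (leqnSn _)) subrr.
  exact: (safety_envelope0 _ ball_sub _ _ envE kN).
Qed.

Lemma plan_in_stateset {R : realType} {M : finType} {S : network R M}
    {i : M} {x : 'cV[R]_(sdim S i)} {P E : nat -> set 'cV[R]_3}
    {z : plan R (sdim S i) (idim S i)} :
  fhocp_constraints x P E z ->
  forall m, (m <= horizon S)%N -> stateset (plan_x z m).
Proof.
move=> [_ [dz [_ [_ [zN _ Xbar _]]]]] m.
by rewrite leq_eqVlt => /predU1P[->|/dz[]//]; rewrite zN.
Qed.

Lemma convex_set1 {R : numDomainType} {V : lmodType R} (a : V) :
  convex_set [set a].
Proof. by move=> p q l /set_mem -> /set_mem ->; apply/mem_set; rewrite convmm. Qed.

(** Singletons are the smallest possible cells, and [planned_balls_disjoint]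
    separates them for all pairs of agents, hence for every graph that time
    t + 1 may bring. *)
Lemma plans_enclosable {R : realType} {M : finType} {S : network R M}
    (ball_sub : eball (eps S / 2) `<=` commset S 0)
    {E : M -> nat -> set 'cV[R]_3} {r : run S} (t : nat) :
  (forall i, safety_envelope S (E i)) -> admissible (state r t) (cells r t) ->
  (forall i, fhocp_constraints (state r t i) (cells r t i) (E i) (sol r t i)) ->
  exists Q, [/\ are_cells S Q, admissible (state r t.+1) Q & follows_plan r t Q].
Proof.
move=> envE adm zP; exists (fun i k => [set planned_pos r t i k]); split=> //.
- move=> i k _; split; first exact: convex_set1.
  move=> _ ->; eexists; last by [].
  by apply: (plan_in_stateset (zP i)); exact: geq_minr.
- move=> i j k [ij _] _.
  apply: (planned_balls_disjoint ball_sub envE adm zP); last exact: geq_minr.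
  by rewrite eq_sym.
Qed.

Theorem theorem1 (R : realType) (M : finType) (S : network R M)
    (E : M -> nat -> set 'cV[R]_3) (r : run S)
    (dim_ge3 : forall i, (3 <= sdim S i)%N)
    (horizon_ge1 : (1 <= horizon S)%N)
    (eps_gt0 : 0 < eps S)
    (dyn_inv : position_invariant S)
    (comm_polytope : is_polytope (comm_A S) (comm_b S))
    (comm_sym : centrally_symmetric (polyhedron (comm_A S) (comm_b S)))
    (ball_sub_comm : eball (eps S / 2) `<=` commset S 0)
    (envelopes : forall i, safety_envelope S (E i))
    (cells_ok : forall t, are_cells S (cells r t))
    (cells_admissible : forall t, admissible (state r t) (cells r t))
    (loop : closed_loop E r)
    (feasible0 : forall i, feasible_at E r 0 i) :
  recursively_feasible E r /\
  (forall t i, feasible_at E r t i) /\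
  (forall t i, stateset (state r t i) /\ inputset (input r t i)) /\
  (forall t i j, i != j ->
     0 <= enorm (pos (state r t i) - pos (state r t j)) - eps S).
Proof.
have [step opt keep] := loop.
have next : recursively_feasible E r.
  move=> t feas applied.
  have zP i := (applied i).1.1.
  have follow : follows_plan r t (cells r t.+1).
    apply: keep => //.
    exact: (plans_enclosable ball_sub_comm t envelopes (cells_admissible t) zP).
  move=> i; rewrite /feasible_at step (applied i).2; eexists.
  apply: (shifted_plan_feasible horizon_ge1 ball_sub_comm (envelopes i) (zP i)).
  by move=> k kN; exact: follow.
have feas t i : feasible_at E r t i.
  elim: t i => [|t IH]; first exact: feasible0.
  by apply: next => // i; exact: opt.
have zP t i := (opt t i (feas t i)).1.1.
split=> //; split=> //; split=> t i.
  have [x0 [dz _]] := zP t i; have [_ Xx Uu] := dz 0%N horizon_ge1.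
  by rewrite (opt t i (feas t i)).2 -x0.
move=> j ij; rewrite subr_ge0; apply: enorm_ge_of_disjoint_balls.
have x0 k : plan_x (sol r t k) 0 = state r t k := (zP t k).1.
rewrite -!x0.
exact: (planned_balls_disjoint ball_sub_comm envelopes (cells_admissible t)
          (zP t)).
Qed.
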